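(* The ring $M_2(\mathbb{Z})^{16}$ has $2$ generators, while the smallest number of generators of the ring $M_2(\mathbb{Z})^{17}$ is $3$. More generally, for every integer $m \geq 2$, $$\mathrm{gen}_{m,2}(\mathbb{Z}) = \frac{16^m - 3 \cdot 8^{m} + 2 \cdot 4^m}{6}.$$
   Context: $M_2(\mathbb{Z})^k$ is the direct sum of $k$ copies of the ring of $2\times 2$ integer matrices with componentwise operations. A set $S$ generates a ring $A$ if every element of $A$ is a $\mathbb{Z}$-linear combination of nonempty products of elements of $S$ (the identity element is not automatically included). A ring ''has (admits) $m$ generators'' if it can be generated by $m$ elements. $\mathrm{gen}_{m,2}(\mathbb{Z})$ is the integer such that the ring $M_2(\mathbb{Z})^{\mathrm{gen}_{m,2}(\mathbb{Z})}$ admits $m$ generators, while $M_2(\mathbb{Z})^{1+\mathrm{gen}_{m,2}(\mathbb{Z})}$ needs at least $m+1$ generators. *)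

(* Defs.v *)
From HB Require Import structures.
From mathcomp Require Import all_boot all_order all_algebra.

Set Implicit Arguments.
Unset Strict Implicit.
Unset Printing Implicit Defensive.

Import GRing.Theory.
Local Open Scope ring_scope.

(* Words must be nonempty: 1 is not adjoined to S, even though A has a 1.     *)
Definition generates (A : pzRingType) (S : {pred A}) : Prop :=
  forall a : A, exists c : seq (int * seq A),
    (forall t, t \in c -> t.2 != [::] /\ {subset t.2 <= S}) /\
    a = \sum_(t <- c) (\prod_(x <- t.2) x) *~ t.1.

(* A tuple may repeat entries, so this reads "at most m distinct generators". *)
Definition has_generators (A : pzRingType) (m : nat) : Prop :=
  exists s : m.-tuple A, generates [in s].

Definition smallest_number_of_generators (A : pzRingType) (m : nat) : Prop :=
  has_generators A m /\ forall m' : nat, has_generators A m' -> (m <= m')%N.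

(* M_n(Z)^k; the library ring structure on {ffun _ -> _} is componentwise.    *)
Definition matrix_ring_power (n k : nat) : pzRingType :=
  {ffun 'I_k -> 'M[int]_n}.

(* The defining property of N = gen_{m,n}(Z).                                 *)
Definition is_gen (m n N : nat) : Prop :=
  has_generators (matrix_ring_power n N) m /\
  forall m' : nat,
    has_generators (matrix_ring_power n N.+1) m' -> (m.+1 <= m')%N.

(* Main.v *)
Require Import Defs.
From mathcomp Require Import all_boot all_order all_algebra.
From mathcomp Require Import ring zify.

Set Implicit Arguments.
Unset Strict Implicit.
Unset Printing Implicit Defensive.

Import GRing.Theory.
Local Open Scope ring_scope.

(** Tuples T_1, ..., T_K of m integer matrices generate M_2(Z)^K exactly when,
    modulo every prime p, each of them generates M_2(F_p) and no two are
    conjugate.  Hence gen_{m,2}(Z) is at most the number of conjugacy classes of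
    generating m-tuples of M_2(F_2), and the point is that this number is
    attained over Z.

    Upper bound.  If m elements generate M_2(Z)^K, reduction modulo 2 gives K
    tuples in M_2(F_2); they generate, they are pairwise non-conjugate, and the
    six elements of GL_2(F_2) act freely on them, because a matrix commuting
    with everything is scalar.  So there are 6K distinct generating tuples
    ([orbit_tuple_inj]).  A generating tuple lies in none of the four maximal
    subrings of M_2(F_2), the stabilisers of the three lines of F_2^2 and a copy
    of F_4 ([orbit_tuple_proper]).  Inclusion-exclusion ([card_bad]) leaves
    16^m - 3 8^m + 2 4^m tuples.

    Lower bound.  It suffices to find, over Z, as many m-tuples such that each
    one generates M_2(Z) and, for any two of them, some noncommutative
    polynomial takes the value 1 on the first and 0 on the second
    ([has_generators_of_family]).  Since every two-sided ideal of M_2(Z) that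
    contains a matrix with an entry 1 or -1 is everything, it is enough that
    some polynomial vanishes on one of the two tuples and has such an entry on
    the other ([distinguished_separated]); this replaces non-conjugacy modulo
    all primes at once.

    The tuples are normal forms modulo 2, lifted to Z in such a way that two
    choices made at the same step, such as 0 and 1 for a coefficient, differ by
    a unit of Z.  A tuple is built by adding matrices at the front.
    As long as its entries commute it consists of scalars 0 or 1, then some
    nonscalar X, then elements a + b X with a, b in {0, 1}.  The first matrix
    that does not commute with X makes the tuple generate either everything
    (16 pairs up to conjugacy) or the ring of upper triangular matrices (12
    pairs).  Once the tuple generates the triangular matrices, the next matrix
    is triangular or has lower left entry 1; once it generates everything, the
    next matrix has arbitrary entries 0 or 1.  With c, d, f the numbers of
    commutative, triangular and full tuples of length m, the next values are
    2^m + 4 c, then 12 c + 8 d, then 16 c + 8 d + 16 f, and the recurrence gives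
    6 f = 16^m - 3 8^m + 2 4^m ([card_full_index]).  Two tuples in different
    stages are told apart by commutators: [f, g] vanishes on commutative tuples,
    [f, g]^2 vanishes on triangular ones, and at the later stages both have an
    entry 1 for suitable f and g. *)

(** * Noncommutative polynomials with integer coefficients *)

Inductive expr :=
  | Var of nat | One | Add of expr & expr | Opp of expr | Mul of expr & expr.

Fixpoint eval (A : pzRingType) (rho : nat -> A) (f : expr) : A :=
  match f with
  | Var k => rho k
  | One => 1
  | Add f g => eval rho f + eval rho g
  | Opp f => - eval rho f
  | Mul f g => eval rho f * eval rho g
  end.

Fixpoint rename (s : nat -> nat) (f : expr) : expr :=
  match f with
  | Var k => Var (s k)
  | One => One
  | Add f g => Add (rename s f) (rename s g)
  | Opp f => Opp (rename s f)
  | Mul f g => Mul (rename s f) (rename s g)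
  end.

Definition Minus f g := Add f (Opp g).
Definition Com f g := Minus (Mul f g) (Mul g f).

Lemma eval_rename (A : pzRingType) (rho : nat -> A) s f :
  eval rho (rename s f) = eval (rho \o s) f.
Proof. by elim: f => //= [f -> g ->|f ->|f -> g ->]. Qed.

Lemma eval_ext (A : pzRingType) (rho rho' : nat -> A) f :
  rho =1 rho' -> eval rho f = eval rho' f.
Proof. by move=> e; elim: f => //= [f -> g ->|f ->|f -> g ->]. Qed.

Lemma eval_comm (A : pzRingType) (rho : nat -> A) z f :
  (forall k, GRing.comm z (rho k)) -> GRing.comm z (eval rho f).
Proof.
move=> h; elim: f => //= [|f hf g hg|f hf|f hf g hg].
- exact: commr1.
- exact: commrD.
- exact: commrN.
- exact: commrM.
Qed.

(** * The non-unital subring generated by a set *)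

Section Spanned.
Variables (A : pzRingType) (S : {pred A}).

Definition spanned (a : A) : Prop :=
  exists c : seq (int * seq A),
    (forall t, t \in c -> t.2 != [::] /\ {subset t.2 <= S}) /\
    a = \sum_(t <- c) (\prod_(x <- t.2) x) *~ t.1.

Lemma spanned0 : spanned 0.
Proof. by exists [::]; split=> //; rewrite big_nil. Qed.

Lemma spanned_mem x : x \in S -> spanned x.
Proof.
move=> xS; exists [:: (1%Z, [:: x])]; split; last by rewrite !big_seq1.
by move=> t; rewrite inE => /eqP ->; split=> // y; rewrite inE => /eqP ->.
Qed.

Lemma spannedD a b : spanned a -> spanned b -> spanned (a + b).
Proof.
move=> [c [hc ->]] [d [hd ->]]; exists (c ++ d); rewrite big_cat; split=> //.
by move=> t; rewrite mem_cat => /orP[/hc|/hd].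
Qed.

Lemma spannedM a b : spanned a -> spanned b -> spanned (a * b).
Proof.
move=> [c [hc ->]] [d [hd ->]].
exists [seq (t.1 * u.1, t.2 ++ u.2) | t <- c, u <- d]; split.
  move=> _ /allpairsP[[t u] [/= /hc[t0 tS] /hd[u0 uS] ->]] /=; split.
    by case: (t.2) t0.
  by move=> x; rewrite mem_cat => /orP[/tS|/uS].
rewrite big_allpairs_dep big_distrl; apply: eq_bigr => t _.
rewrite big_distrr; apply: eq_bigr => u _ /=.
by rewrite big_cat /= mulrzAr mulrzAl -mulrzA.
Qed.

Lemma spannedMz a z : spanned a -> spanned (a *~ z).
Proof.
move=> [c [hc ->]]; exists [seq (t.1 * z, t.2) | t <- c]; split.
  by move=> _ /mapP[t /hc ? ->].
by rewrite big_map mulrz_suml; apply: eq_bigr => t _; rewrite mulrzA.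
Qed.

Lemma spannedN a : spanned a -> spanned (- a).
Proof. by move/(spannedMz (-1)); rewrite mulrN1z. Qed.

Lemma spanned_sum (I : finType) (F : I -> A) :
  (forall i, spanned (F i)) -> spanned (\sum_i F i).
Proof. by move=> h; apply: big_ind => //; [exact: spanned0|exact: spannedD]. Qed.

(** Adjoining 1 to a subring only adds the integer multiples of 1. *)
Lemma eval_spanned (rho : nat -> A) f :
  (forall k, spanned (rho k)) -> exists z : int, spanned (eval rho f - z%:~R).
Proof.
move=> h; elim: f => /= [k||f [z hz] g [w hw]|f [z hz]|f [z hz] g [w hw]].
- by exists 0; rewrite subr0.
- by exists 1; rewrite subrr; apply: spanned0.
- by exists (z + w); rewrite rmorphD /= opprD addrACA; apply: spannedD.
- by exists (- z); rewrite rmorphN /= -opprD; apply: spannedN.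
exists (z * w); set x := eval rho f in hz *; set y := eval rho g in hw *.
have -> : x * y - (z * w)%:~R =
    (x - z%:~R) * (y - w%:~R) + (y - w%:~R) *~ z + (x - z%:~R) *~ w.
  rewrite -(mulrzl (y - _)) -(mulrzr (x - _)) -mulrDl subrK mulrBr mulrBl.
  by rewrite subrKA intrM.
by apply: spannedD; last exact: spannedMz; apply: spannedD;
  [exact: spannedM|exact: spannedMz].
Qed.

End Spanned.

(** * Tuples of integer matrices and the polynomials telling them apart *)

Local Notation M2Z := 'M[int]_2.

Lemma ord2_ind (P : 'I_2 -> Prop) : P 0 -> P 1 -> forall i, P i.
Proof.
move=> P0 P1 [[|[|i]] hi] //.
  by rewrite (_ : Ordinal hi = 0) //; apply/val_inj.
by rewrite (_ : Ordinal hi = 1) //; apply/val_inj.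
Qed.

Lemma mulmx2E (R : pzRingType) (M N : 'M[R]_2) i j :
  (M * N) i j = M i 0 * N 0 j + M i 1 * N 1 j.
Proof.
rewrite mxE big_ord_recl big_ord1.
by rewrite (_ : lift ord0 ord0 = 1) //; apply/val_inj.
Qed.

Lemma delta_mx2_sum (R : pzRingType) : delta_mx 0 0 + delta_mx 1 1 = 1 :> 'M[R]_2.
Proof.
by apply/matrixP; elim/ord2_ind; elim/ord2_ind; rewrite !mxE /= ?(addr0, add0r).
Qed.

(** The default 0 of [nth] makes the variables beyond the length of the tuple
    vanish. *)
Definition ev (T : seq M2Z) (f : expr) : M2Z := eval (nth 0 T) f.

Definition reach (T : seq M2Z) (M : M2Z) : Prop := exists f, ev T f = M.

Definition full (T : seq M2Z) : Prop := forall M, reach T M.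

(** Reducing modulo a prime p turns a polynomial as below into a proof that the
    two reductions are not conjugate over F_p. *)
Definition separated (S T : seq M2Z) : Prop :=
  exists f, ev S f = 1 /\ ev T f = 0.

Definition has_unit (M : M2Z) : Prop := exists i j, M i j * M i j = 1.

Definition distinguished (S T : seq M2Z) : Prop :=
  exists f, ev S f = 0 /\ has_unit (ev T f) \/ ev T f = 0 /\ has_unit (ev S f).

Lemma distinguished_sym S T : distinguished S T -> distinguished T S.
Proof. by case=> f [] h; exists f; [right|left]. Qed.

Lemma separated_sym S T : separated S T -> separated T S.
Proof.
case=> f [hS hT]; exists (Minus One f).
by rewrite /ev /= -!/(ev _ f) hS hT subrr subr0.
Qed.

(** Two-sided multiplication by matrix units, available because S is full,
    moves an entry of f(S) to both places of the diagonal; if the entry is 1 or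
    -1, it is its own inverse. *)
Lemma full_unit_separated S T f :
  full S -> ev T f = 0 -> has_unit (ev S f) -> separated S T.
Proof.
move=> fS f0 [a [b hu]]; set u := ev S f a b in hu.
have [g0 hg0] := fS (delta_mx 0 a); have [g1 hg1] := fS (delta_mx 1 a).
have [h0 hh0] := fS (delta_mx b 0); have [h1 hh1] := fS (delta_mx b 1).
have [w hw] := fS u%:M.
exists (Mul w (Add (Mul (Mul g0 f) h0) (Mul (Mul g1 f) h1))).
rewrite /ev /= -!/(ev _ _) f0 !(mulr0, mul0r) addr0 mulr0; split=> //.
rewrite hg0 hg1 hh0 hh1 hw /GRing.mul /=.
have e i : delta_mx i a *m ev S f *m delta_mx b i = u *: delta_mx i i.
  apply/matrixP=> j k; rewrite !mxE (bigD1 b) //= big1 => [|l /negbTE lb].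
    rewrite !mxE eqxx /= addr0 (bigD1 a) //= big1 => [|l /negbTE la].
      rewrite !mxE eqxx andbT addr0 -!/u.
      by case: (j == i); case: (k == i); rewrite /= ?(mul1r, mulr1, mul0r, mulr0).
    by rewrite !mxE la andbF mul0r.
  by rewrite !mxE lb mulr0.
by rewrite !e -scalerDr mul_scalar_mx scalerA hu scale1r delta_mx2_sum.
Qed.

Lemma distinguished_separated S T :
  full S -> full T -> distinguished S T -> separated S T.
Proof.
move=> fS fT [f [[f0 fu]|[f0 fu]]]; last exact: full_unit_separated f0 fu.
by apply: separated_sym; apply: full_unit_separated f0 fu.
Qed.

(** * Generating a power of the matrix ring from separated tuples *)

Section Family.
Variables (K m : nat) (T : 'I_K -> seq M2Z).
Hypothesis size_T : forall i, size (T i) = m.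
Hypothesis full_T : forall i, full (T i).
Hypothesis sep_T : forall i j, i != j -> separated (T i) (T j).

Local Notation A := (matrix_ring_power 2 K).

Let col k : A := [ffun i => nth 0 (T i) k].
Let single (i : 'I_K) (M : M2Z) : A := [ffun j => if j == i then M else 0].

Lemma eval_col f i : eval col f i = ev (T i) f.
Proof.
by elim: f => [k||f hf g hg|f hf|f hf g hg] /=; rewrite ffunE /ev /= ?hf ?hg.
Qed.

Lemma singleM i M N : single i M * single i N = single i (M * N).
Proof.
by apply/ffunP=> j; rewrite !ffunE; case: (j == i) => //; rewrite mul0r.
Qed.

Lemma sum_single (a : A) : a = \sum_i single i (a i).
Proof.
apply/ffunP=> j; rewrite sum_ffunE (bigD1 j) //= ffunE eqxx big1 ?addr0 //.
by move=> i /negbTE ij; rewrite ffunE eq_sym ij.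
Qed.

(** As in the Chinese remainder theorem, the product over j of the polynomials
    separating i from j is the idempotent of the i-th factor. *)
Lemma exists_eval_single i M : exists f, eval col f = single i M.
Proof.
have idem : exists f, ev (T i) f = 1 /\ forall j, j != i -> ev (T j) f = 0.
  suff [f [f1 f0]] : exists f, ev (T i) f = 1 /\
      forall j, j \in enum 'I_K -> j != i -> ev (T j) f = 0.
    by exists f; split=> // j; apply: f0; rewrite mem_enum.
  elim: (enum _) => [|j s [f [f1 f0]]]; first by exists One.
  have [->|ji] := eqVneq j i.
    exists f; split=> // k; rewrite inE => /orP[/eqP ->|/f0 //].
    by rewrite eqxx.
  have [g [g1 g0]] : separated (T i) (T j) by apply: sep_T; rewrite eq_sym.
  exists (Mul f g); rewrite /ev /= -!/(ev _ _) f1 g1 mulr1; split=> // k.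
  rewrite inE /ev /= -!/(ev _ _) => /orP[/eqP -> _|ks ki].
    by rewrite g0 mulr0.
  by rewrite f0 // mul0r.
have [f [f1 f0]] := idem; have [g hg] := full_T i M.
exists (Mul f g); apply/ffunP=> j; rewrite eval_col ffunE /ev /= -!/(ev _ _).
by case: eqVneq => [->|ji]; [rewrite f1 hg mul1r|rewrite f0 // mul0r].
Qed.

(** Polynomials with a constant term already reach everything, so the non-unital
    span of the generators is a two-sided ideal.  To see that it is the whole
    ring, subtract from the element E_01 of the i-th factor the constant term z
    of a polynomial representing it: E_01 - z is in the span, and multiplying it
    by E_00 and E_11 kills z. *)
Lemma has_generators_of_family : has_generators A m.
Proof.
exists [tuple col k | k < m]; set S : {pred A} := [in _].
have Scol k : spanned S (col k).
  have [km|mk] := ltnP k m.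
    by apply: spanned_mem; apply/mapP; exists (Ordinal km); rewrite ?mem_enum.
  have -> : col k = 0; last exact: spanned0.
  by apply/ffunP=> i; rewrite !ffunE nth_default // size_T.
have ideal f a : spanned S a ->
    spanned S (eval col f * a) /\ spanned S (a * eval col f).
  elim: f a => [k||f hf g hg|f hf|f hf g hg] a Sa /=.
  - by split; apply: spannedM.
  - by rewrite mul1r mulr1.
  - have [[fl fr] [gl gr]] := (hf _ Sa, hg _ Sa).
    by rewrite mulrDl mulrDr; split; apply: spannedD.
  - by have [] := hf _ Sa; rewrite mulNr mulrN; split; apply: spannedN.
  have [[_ fr] [gl _]] := (hf _ Sa, hg _ Sa).
  have [fl _] := hf _ gl; have [_ gr] := hg _ fr.
  by split; [rewrite -mulrA|rewrite mulrA].
have idealS i M a : spanned S a ->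
    spanned S (single i M * a) /\ spanned S (a * single i M).
  by move=> Sa; have [f <-] := exists_eval_single i M; apply: ideal.
have S01 i : spanned S (single i (delta_mx 0 1)).
  have [f hf] := exists_eval_single i (delta_mx 0 1).
  have [z] := eval_spanned f Scol; rewrite hf => hz.
  have [/(idealS i (delta_mx 1 1))[_ hz'] _] := idealS i (delta_mx 0 0) _ hz.
  suff <- : single i (delta_mx 0 0) * (single i (delta_mx 0 1) - z%:~R)
      * single i (delta_mx 1 1) = single i (delta_mx 0 1) by [].
  rewrite mulrBr mulrBl mulrzr mulrzAl !singleM.
  rewrite /GRing.mul /= !mul_delta_mx mul_delta_mx_0 //.
  suff -> : single i 0 = 0 by rewrite mul0rz subr0.
  by apply/ffunP=> j; rewrite !ffunE if_same.
have S1 i : spanned S (single i 1).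
  have -> : single i 1 = single i (delta_mx 0 1) * single i (delta_mx 1 0) +
      single i (delta_mx 1 0) * single i (delta_mx 0 1).
    rewrite !singleM; apply/ffunP=> j; rewrite !ffunE.
    case: (j == i); rewrite ?addr0 //.
    by rewrite -delta_mx2_sum /GRing.mul /= !mul_delta_mx.
  by apply: spannedD; have [] := idealS i (delta_mx 1 0) _ (S01 i).
move=> a; rewrite -/(spanned S a) [a]sum_single; apply: spanned_sum => i.
by rewrite -[a i]mul1r -singleM; have [] := idealS i (a i) _ (S1 i).
Qed.

End Family.

(** * Explicit two by two matrices *)

Definition mx (a b c d : int) : M2Z :=
  \matrix_(i, j) if i == 0 then (if j == 0 then a else b)
                 else (if j == 0 then c else d).

Lemma mxE00 a b c d : mx a b c d 0 0 = a. Proof. by rewrite mxE. Qed.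
Lemma mxE01 a b c d : mx a b c d 0 1 = b. Proof. by rewrite mxE. Qed.
Lemma mxE10 a b c d : mx a b c d 1 0 = c. Proof. by rewrite mxE. Qed.
Lemma mxE11 a b c d : mx a b c d 1 1 = d. Proof. by rewrite mxE. Qed.
Definition mx_E := (mxE00, mxE01, mxE10, mxE11).

Lemma mx_entries (M : M2Z) : M = mx (M 0 0) (M 0 1) (M 1 0) (M 1 1).
Proof.
by apply/matrixP; elim/ord2_ind; elim/ord2_ind; rewrite mx_E.
Qed.

Lemma mxD a b c d a' b' c' d' :
  mx a b c d + mx a' b' c' d' = mx (a + a') (b + b') (c + c') (d + d').
Proof.
by apply/matrixP; elim/ord2_ind; elim/ord2_ind; rewrite mxE !mx_E.
Qed.

Lemma mxN a b c d : - mx a b c d = mx (- a) (- b) (- c) (- d).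
Proof.
by apply/matrixP; elim/ord2_ind; elim/ord2_ind; rewrite mxE !mx_E.
Qed.

Lemma mxM a b c d a' b' c' d' :
  mx a b c d * mx a' b' c' d' =
  mx (a * a' + b * c') (a * b' + b * d') (c * a' + d * c') (c * b' + d * d').
Proof.
by apply/matrixP; elim/ord2_ind; elim/ord2_ind; rewrite mulmx2E !mx_E.
Qed.

Lemma mx_scalar a : a%:M = mx a 0 0 a.
Proof.
by apply/matrixP; elim/ord2_ind; elim/ord2_ind; rewrite mxE !mx_E ?mulr1n ?mulr0n.
Qed.

Lemma mx1 : 1 = mx 1 0 0 1. Proof. exact: mx_scalar. Qed.
Lemma mx0 : 0 = mx 0 0 0 0. Proof. by rewrite -mx_scalar raddf0. Qed.

(** * The pairs that generate the full and the triangular matrix ring *)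

(** Matrices as bare quadruples, on which evaluation computes. *)
Definition quad : Type := int * int * int * int.
Definition quad_mx (q : quad) : M2Z := let: (a, b, c, d) := q in mx a b c d.

Fixpoint ev_quad (T : seq quad) (f : expr) : quad :=
  match f with
  | Var k => nth (0, 0, 0, 0) T k
  | One => (1, 0, 0, 1)
  | Add f g =>
    let: (a, b, c, d) := ev_quad T f in let: (a', b', c', d') := ev_quad T g in
    (a + a', b + b', c + c', d + d')
  | Opp f => let: (a, b, c, d) := ev_quad T f in (- a, - b, - c, - d)
  | Mul f g =>
    let: (a, b, c, d) := ev_quad T f in let: (a', b', c', d') := ev_quad T g in
    (a * a' + b * c', a * b' + b * d', c * a' + d * c', c * b' + d * d')
  end.

Lemma ev_quad_mx T f : ev [seq quad_mx q | q <- T] f = quad_mx (ev_quad T f).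
Proof.
elim: f => [k||f hf g hg|f hf|f hf g hg]; rewrite /ev /= -?/(ev _ _) ?hf ?hg.
- have [kT|Tk] := ltnP k (size T); first exact: nth_map.
  by rewrite !nth_default ?size_map // mx0.
- exact: mx1.
- by case: ev_quad => [[[? ?] ?] ?]; case: ev_quad => [[[? ?] ?] ?] /=; rewrite mxD.
- by case: ev_quad => [[[? ?] ?] ?]; rewrite /= mxN.
- by case: ev_quad => [[[? ?] ?] ?]; case: ev_quad => [[[? ?] ?] ?] /=; rewrite mxM.
Qed.

Definition quad_unit (q : quad) : bool :=
  let: (a, b, c, d) := q in
  [|| a * a == 1, b * b == 1, c * c == 1 | d * d == 1].

Lemma quad_unitP q : quad_unit q -> has_unit (quad_mx q).
Proof.
case: q => [[[a b] c] d] /or4P[] /eqP h.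
- by exists 0, 0; rewrite mx_E.
- by exists 0, 1; rewrite mx_E.
- by exists 1, 0; rewrite mx_E.
- by exists 1, 1; rewrite mx_E.
Qed.

Definition quad_zero (q : quad) : bool :=
  let: (a, b, c, d) := q in [&& a == 0, b == 0, c == 0 & d == 0].

Lemma quad_zeroP q : quad_zero q -> quad_mx q = 0.
Proof.
by case: q => [[[a b] c] d] /and4P[/eqP -> /eqP -> /eqP -> /eqP ->]; rewrite mx0.
Qed.

Definition distinguished_quad (S T : seq quad) (f : expr) : bool :=
  quad_zero (ev_quad S f) && quad_unit (ev_quad T f) ||
  quad_zero (ev_quad T f) && quad_unit (ev_quad S f).

Lemma distinguished_quadP S T fs : has (distinguished_quad S T) fs ->
  distinguished (map quad_mx S) (map quad_mx T).
Proof.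
elim: fs => //= f fs IH /orP[/orP[]/andP[/quad_zeroP h0 /quad_unitP h1]|//].
  by exists f; left; rewrite !ev_quad_mx h0.
by exists f; right; rewrite !ev_quad_mx h0.
Qed.

Definition bit (b : bool) : expr := if b then One else Minus One One.

Lemma eval_bit (A : pzRingType) (rho : nat -> A) b : eval rho (bit b) = b%:R.
Proof. by case: b; rewrite //= subrr. Qed.

(** Lifts [:: Z; X] of the 16 conjugacy classes of generating pairs of M_2(F_2).
    The four values of X have the four characteristic polynomials modulo 2: they
    are nilpotent, unipotent, idempotent, and a root of x^2 - x - 1, which
    modulo 2 is the polynomial of F_4.  For each X there are four classes of Z,
    and they are lifted so that the pair generates M_2(Z) with 1. *)
Definition pairs_full : seq (seq quad) :=
  [:: [:: (0, 0, 1, 0); (0, 1, 0, 0)]; [:: (0, 1, 1, 0); (0, 1, 0, 0)];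
      [:: (1, 0, 1, 0); (0, 1, 0, 0)]; [:: (1, 1, 1, 0); (0, 1, 0, 0)];
      [:: (0, 0, 1, 0); (1, 1, 0, 1)]; [:: (0, 1, 1, 0); (1, 1, 0, 1)];
      [:: (1, 0, 1, 0); (1, 1, 0, 1)]; [:: (1, 1, 1, 0); (1, 1, 0, 1)];
      [:: (0, 1, 1, 0); (1, 0, 0, 0)]; [:: (0, 1, 1, 1); (1, 0, 0, 0)];
      [:: (1, 1, 1, 0); (1, 0, 0, 0)]; [:: (1, 1, 1, 1); (1, 0, 0, 0)];
      [:: (0, 1, 0, 0); (0, 1, 1, 1)]; [:: (1, 0, 0, 0); (0, 1, 1, 1)];
      [:: (0, 0, 0, 1); (0, 1, 1, 1)]; [:: (1, -1, 0, 1); (0, 1, 1, 1)]].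

(** Lifts [:: Y; X] of the 12 classes, under conjugation by triangular matrices,
    of pairs that generate the upper triangular matrices modulo 2 together with
    1.  If the diagonal entries of X differ, conjugation clears the upper right
    entry of X; otherwise it clears that of Y. *)
Definition pairs_borel : seq (seq quad) :=
  [:: [:: (0, 1, 0, 0); (1, 0, 0, 0)]; [:: (0, 1, 0, 1); (1, 0, 0, 0)];
      [:: (1, 1, 0, 0); (1, 0, 0, 0)]; [:: (1, 1, 0, 1); (1, 0, 0, 0)];
      [:: (0, 1, 0, 0); (0, 0, 0, 1)]; [:: (0, 1, 0, 1); (0, 0, 0, 1)];
      [:: (1, 1, 0, 0); (0, 0, 0, 1)]; [:: (1, 1, 0, 1); (0, 0, 0, 1)];
      [:: (1, 0, 0, 0); (0, 1, 0, 0)]; [:: (0, 0, 0, 1); (0, 1, 0, 0)];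
      [:: (1, 0, 0, 0); (1, 1, 0, 1)]; [:: (0, 0, 0, 1); (1, 1, 0, 1)]].

Local Notation varZ := (Var 0).
Local Notation varX := (Var 1).
Local Notation "f ** g" := (Mul f g) (at level 40, left associativity).

(** Annihilating polynomials of X and of Z, compressions X Z X and
    (1 - X) Z (1 - X) reading off the diagonal of Z when X is idempotent, and
    words that tell apart the few remaining pairs. *)
Definition candidates : seq expr :=
  [:: varX ** varX; Minus varX One ** Minus varX One; Minus (varX ** varX) varX;
      varZ ** varX ** varZ; Com varX varZ ** varX; Com varX varZ ** varZ] ++
  [seq Minus (varZ ** varZ) (Add (bit s ** varZ) (bit e))
     | s <- [:: true; false], e <- [:: true; false]] ++
  [seq Minus (varX ** varZ ** varX) (bit s ** varX) | s <- [:: true; false]] ++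
  [seq Minus (Minus One varX ** varZ ** Minus One varX) (bit s ** Minus One varX)
     | s <- [:: true; false]].

Definition pairwise_distinguished (P : seq (seq quad)) : bool :=
  pairwise (fun S T => has (distinguished_quad S T) candidates) P.

Lemma pairs_full_distinguished : pairwise_distinguished pairs_full.
Proof. by vm_compute. Qed.

Lemma pairs_borel_distinguished : pairwise_distinguished pairs_borel.
Proof. by vm_compute. Qed.

Fixpoint num (n : nat) : expr :=
  if n is n'.+1 then Add One (num n') else Minus One One.

Definition intq (n : int) : expr :=
  match n with Posz n => num n | Negz n => Opp (num n.+1) end.

(** When det [X, Z] is 1 or -1, the matrices 1, X, Z, X Z are a basis of M_2(Z)
    over Z, so the matrix units are combinations of them; for the pairs above,
    coefficients of absolute value at most 2 are enough to obtain all the matrix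
    units of the ring that they generate with 1. *)
Definition combos : seq expr :=
  let coefs := [:: -2; -1; 0; 1; 2] in
  let lin f g :=
    [seq Add (intq a ** f) (intq b ** g) | a <- coefs, b <- coefs] in
  [seq Add f g | f <- lin One varX, g <- lin varZ (varX ** varZ)].

Definition quad_eq (p q : quad) := quad_zero (let: (a, b, c, d) := p in
   let: (a', b', c', d') := q in (a - a', b - b', c - c', d - d')).

Definition reach_quad (T : seq quad) (q : quad) : bool :=
  has (fun f => quad_eq (ev_quad T f) q) combos.

Lemma reach_quadP T q : reach_quad T q -> reach (map quad_mx T) (quad_mx q).
Proof.
rewrite /reach_quad; elim: combos => //= f fs IH /orP[h|/IH //].
exists f; rewrite ev_quad_mx; apply/eqP; rewrite -subr_eq0.
case: (ev_quad T f) q h {IH} => [[[a b] c] d] [[[a' b'] c'] d'] /quad_zeroP /= h.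
by rewrite mxN mxD h.
Qed.

Lemma pairs_full_reach :
  all (fun T => [&& reach_quad T (1, 0, 0, 0), reach_quad T (0, 1, 0, 0),
    reach_quad T (0, 0, 1, 0) & reach_quad T (0, 0, 0, 1)]) pairs_full.
Proof. by vm_compute. Qed.

Lemma pairs_borel_reach :
  all (fun T => [&& reach_quad T (1, 0, 0, 0), reach_quad T (0, 1, 0, 0)
    & reach_quad T (0, 0, 0, 1)]) pairs_borel.
Proof. by vm_compute. Qed.

Section Reach.
Variable T : seq M2Z.

Lemma reach_nth k : reach T (nth 0 T k). Proof. by exists (Var k). Qed.

Lemma reachD M N : reach T M -> reach T N -> reach T (M + N).
Proof. by case=> f <- [g <-]; exists (Add f g). Qed.

Lemma reachM M N : reach T M -> reach T N -> reach T (M * N).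
Proof. by case=> f <- [g <-]; exists (Mul f g). Qed.

Lemma reachZ M a : reach T M -> reach T (a%:M * M).
Proof.
case=> f <-; exists (Mul (intq a) f); rewrite /ev /=; congr (_ * _).
have eval_num n : eval (nth 0 T) (num n) = (n%:Z)%:M.
  elim: n => [|n IH]; first by rewrite /= subrr raddf0.
  by rewrite /= IH intS raddfD.
case: a => n; first exact: eval_num.
by rewrite NegzE raddfN /=; congr (- _); exact: (eval_num n.+1).
Qed.

Definition reach_borel := forall a b d, reach T (mx a b 0 d).

Lemma reach_borelI : reach T (mx 1 0 0 0) -> reach T (mx 0 1 0 0) ->
  reach T (mx 0 0 0 1) -> reach_borel.
Proof.
move=> /reachZ h1 /reachZ h2 /reachZ h3 a b d.
have := reachD (reachD (h1 a) (h2 b)) (h3 d).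
by rewrite !mx_scalar !mxM !mxD !(mulr1, mulr0, mul0r, addr0, add0r).
Qed.

Lemma fullI : reach_borel -> reach T (mx 0 0 1 0) -> full T.
Proof.
move=> hB /reachZ hc M; rewrite (mx_entries M).
have := reachD (hB (M 0 0) (M 0 1) (M 1 1)) (hc (M 1 0)).
by rewrite mx_scalar mxM mxD !(mulr1, mulr0, mul0r, addr0, add0r).
Qed.

End Reach.

(** Variables may be renamed along any matching of positions; a variable sent
    beyond both lengths becomes 0. *)
Lemma ev_rename s S S' f : (forall k, nth 0 S' (s k) = nth 0 S k) ->
  ev S' (rename s f) = ev S f.
Proof. by move=> hS; rewrite /ev eval_rename; apply: eval_ext. Qed.

Lemma reach_rename s S S' M : (forall k, nth 0 S' (s k) = nth 0 S k) ->
  reach S M -> reach S' M.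
Proof. by move=> hS [f <-]; exists (rename s f); apply: ev_rename. Qed.

Lemma distinguished_rename s S S' T T' :
  (forall k, nth 0 S' (s k) = nth 0 S k) ->
  (forall k, nth 0 T' (s k) = nth 0 T k) ->
  distinguished S T -> distinguished S' T'.
Proof.
move=> /ev_rename hS /ev_rename hT [f hf].
by exists (rename s f); rewrite hS hT.
Qed.

Lemma distinguished_cons Y Z S T :
  distinguished S T -> distinguished (Y :: S) (Z :: T).
Proof. exact: (@distinguished_rename succn). Qed.

Lemma reach_cons Z T M : reach T M -> reach (Z :: T) M.
Proof. exact: (@reach_rename succn). Qed.

Lemma distinguished_diff (S T : seq M2Z) f g :
  ev S f = ev S g -> has_unit (ev T f - ev T g) -> distinguished S T.
Proof.
by move=> e h; exists (Minus f g); left; rewrite /ev /= -!/(ev _ _) e subrr.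
Qed.

(** * The normal forms and their number *)

Definition affine (a b : bool) (X : M2Z) : M2Z := a%:R + b%:R * X.

(** Makes the elements a + b X of a commutative tuple distinct modulo every
    prime; with b = 1 and b' = 0 it says that X is not scalar. *)
Definition spread (X : M2Z) : Prop := forall a b a' b',
  (a, b) != (a', b') -> has_unit (affine a b X - affine a' b' X).

Definition affine_expr (a b : bool) (f : expr) : expr :=
  Add (bit a) (bit b ** f).

Lemma ev_affine T a b f : ev T (affine_expr a b f) = affine a b (ev T f).
Proof. by rewrite /ev /= !eval_bit. Qed.

(** The families are indexed by finite types following the recursion on m, so
    that counting is immediate and only distinct indices have to be told
    apart. *)
Fixpoint scalar_index m : finType :=
  if m is m'.+1 then (bool * scalar_index m')%type else unit.

Fixpoint scalar_tuple m : scalar_index m -> seq M2Z :=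
  if m is m'.+1 then fun i : scalar_index m'.+1 => (i.1)%:R :: scalar_tuple i.2
  else fun _ => [::].

Fixpoint comm_index m : finType :=
  if m is m'.+1 then (scalar_index m' + (bool * bool) * comm_index m')%type
  else void.

Fixpoint comm_tuple (X : M2Z) m : comm_index m -> seq M2Z :=
  if m is m'.+1 then fun i : comm_index m'.+1 =>
    match i with
    | inl s => X :: scalar_tuple s
    | inr (a, b, c) => affine a b X :: comm_tuple X c
    end
  else fun _ => [::].

Fixpoint comm_pos m : comm_index m -> nat :=
  if m is m'.+1 then fun i : comm_index m'.+1 =>
    match i with inl _ => 0 | inr (_, c) => (comm_pos c).+1 end
  else fun _ => 0.

Definition borel_pair (p : 'I_12) := map quad_mx (nth [::] pairs_borel p).
Definition full_pair (p : 'I_16) := map quad_mx (nth [::] pairs_full p).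

Fixpoint borel_index m : finType :=
  if m is m'.+1 then
    ('I_12 * comm_index m' + (bool * bool * bool) * borel_index m')%type else void.

Fixpoint borel_tuple m : borel_index m -> seq M2Z :=
  if m is m'.+1 then fun i : borel_index m'.+1 =>
    match i with
    | inl (p, c) => (borel_pair p)`_0 :: comm_tuple (borel_pair p)`_1 c
    | inr (a, b, d, i') => mx a b 0 d :: borel_tuple i'
    end
  else fun _ => [::].

Fixpoint full_index m : finType :=
  if m is m'.+1 then
    ('I_16 * comm_index m' + (bool * bool * bool) * borel_index m' +
    (bool * bool * bool * bool) * full_index m')%type else void.

Fixpoint full_tuple m : full_index m -> seq M2Z :=
  if m is m'.+1 then fun i : full_index m'.+1 =>
    match i with
    | inl (inl (p, c)) => (full_pair p)`_0 :: comm_tuple (full_pair p)`_1 c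
    | inl (inr (a, b, d, i')) => mx a b 1 d :: borel_tuple i'
    | inr (a, b, c, d, i') => mx a b c d :: full_tuple i'
    end
  else fun _ => [::].

Lemma card_scalar_index m : #|scalar_index m| = (2 ^ m)%N.
Proof.
by elim: m => [|m IH] /=; rewrite ?card_unit // card_prod card_bool IH expnS.
Qed.

Lemma card_comm_index m : (#|comm_index m| * 2 + 2 ^ m = 4 ^ m)%N.
Proof.
elim: m => [|m IH] /=; first by rewrite card_void.
by rewrite card_sum !card_prod !card_bool card_scalar_index !expnS -IH; lia.
Qed.

Lemma card_borel_index m :
  (#|borel_index m| * 2 + 3 * 4 ^ m = 8 ^ m + 2 * 2 ^ m)%N.
Proof.
elim: m => [|m IH] /=; first by rewrite card_void.
rewrite card_sum !card_prod !card_bool card_ord !expnS.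
by have := card_comm_index m; lia.
Qed.

Lemma card_full_index m :
  (#|full_index m| * 6 + 3 * 8 ^ m = 16 ^ m + 2 * 4 ^ m)%N.
Proof.
elim: m => [|m IH] /=; first by rewrite card_void.
rewrite !card_sum !card_prod !card_bool card_ord !expnS.
by have := card_comm_index m; have := card_borel_index m; lia.
Qed.

Lemma size_scalar_tuple m (i : scalar_index m) : size (scalar_tuple i) = m.
Proof. by elim: m i => //= m IH [b i]; rewrite /= IH. Qed.

Lemma size_comm_tuple X m (i : comm_index m) : size (comm_tuple X i) = m.
Proof.
by elim: m i => //= m IH [i|[[a b] i]]; rewrite /= ?IH ?size_scalar_tuple.
Qed.

Lemma size_borel_tuple m (i : borel_index m) : size (borel_tuple i) = m.
Proof.
by elim: m i => //= m IH [[p i]|[[[a b] d] i]]; rewrite /= ?IH ?size_comm_tuple.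
Qed.

Lemma size_full_tuple m (i : full_index m) : size (full_tuple i) = m.
Proof.
by elim: m i => //= m IH [[[p i]|[[[a b] d] i]]|[[[[a b] c] d] i]];
  rewrite /= ?IH ?size_comm_tuple ?size_borel_tuple.
Qed.

Lemma nth_comm_pos X m (i : comm_index m) :
  nth 0 (comm_tuple X i) (comm_pos i) = X.
Proof. by elim: m i => //= m IH [i|[[a b] i]]; rewrite /= ?IH. Qed.

(** Sends the variables of [:: Z; X] to their positions in Z followed by a
    commutative tuple of length n, and the other ones out of range. *)
Definition head_at k n (j : nat) : nat :=
  match j with 0 => 0 | 1 => k.+1 | _ => n.+1 end%N.

Lemma nth_head_at Z X m (i : comm_index m) k :
  nth 0 (Z :: comm_tuple X i) (head_at (comm_pos i) m k) = nth 0 [:: Z; X] k.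
Proof.
case: k => [|[|k]] //=; first exact: nth_comm_pos.
by rewrite nth_nil nth_default // size_comm_tuple.
Qed.

(** * Telling commutative tuples apart *)

Lemma has_unit_bits (a b : bool) : a != b -> has_unit (a%:R - b%:R).
Proof.
by move=> ab; exists 0, 0; case: a b ab => [] [] //= _; rewrite !mxE ?eqxx.
Qed.

Lemma distinguished_scalar_tuple m (i j : scalar_index m) :
  i != j -> distinguished (scalar_tuple i) (scalar_tuple j).
Proof.
elim: m i j => [[] []|m IH [a i] [b j]] //=.
have [-> ab|/IH /distinguished_cons h _] := eqVneq i j; last exact: h.
apply/distinguished_sym/(@distinguished_diff _ _ (Var 0) (bit b));
  rewrite /ev /= eval_bit //.
by apply: has_unit_bits; apply: contraNneq ab => ->.
Qed.

Lemma scalar_tuple_entry m (i : scalar_index m) k :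
  exists b : bool, nth 0 (scalar_tuple i) k = b%:R.
Proof.
elim: m i k => [|m IH] /= i k; first by exists false; rewrite nth_nil.
by case: i k => b i [|k] /=; [exists b|apply: IH].
Qed.

Lemma distinguished_scalar_comm X m (i : scalar_index m) (j : comm_index m) :
  spread X -> distinguished (scalar_tuple i) (comm_tuple X j).
Proof.
move=> hX; have [b hb] := scalar_tuple_entry i (comm_pos j).
apply: (@distinguished_diff _ _ (Var (comm_pos j)) (bit b));
  rewrite /ev /= eval_bit //.
have : has_unit (affine false true X - affine b false X).
  by apply: hX; case: b {hb}.
by rewrite /affine nth_comm_pos mul0r mul1r add0r addr0.
Qed.

(** X and Y may coincide: when the tails have the same index, X and Y stand at
    the same place, and an entry a + b X is compared with the polynomial
    a' + b' x in that place. *)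
Lemma distinguished_comm_tuple X Y m (i j : comm_index m) :
  spread X -> spread Y -> i != j ->
  distinguished (comm_tuple X i) (comm_tuple Y j).
Proof.
move=> hX hY; elim: m i j => [[]|m IH] //= [i|[[a b] i]] [j|[[a' b'] j]] /=.
- move=> ij; apply: distinguished_cons; apply: distinguished_scalar_tuple.
  by apply: contraNneq ij => ->.
- by move=> _; apply/distinguished_cons/distinguished_scalar_comm.
- by move=> _; apply/distinguished_cons/distinguished_sym/distinguished_scalar_comm.
have [<- ab|/IH /distinguished_cons h _] := eqVneq i j; last exact: h.
apply/distinguished_sym/(@distinguished_diff _ _ (Var 0)
  (affine_expr a' b' (Var (comm_pos i).+1))).
  by rewrite ev_affine /ev /= nth_comm_pos.
rewrite ev_affine /ev /= nth_comm_pos; apply: hX.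
by apply: contraNneq ab => -[-> ->].
Qed.

Lemma pair_distinguished P n (p q : 'I_n) :
  pairwise_distinguished P -> size P = n -> p != q ->
  distinguished (map quad_mx (nth [::] P p)) (map quad_mx (nth [::] P q)).
Proof.
move=> /(pairwiseP [::]) hP sP; wlog pq : p q / (p < q)%N => [hw pq|_].
  have [/hw h|qp|/val_inj e] := ltngtP p q; first exact: h.
    by apply: distinguished_sym; apply: hw => //; rewrite eq_sym.
  by rewrite e eqxx in pq.
by apply: distinguished_quadP; apply: hP pq; rewrite inE sP.
Qed.

Lemma borel_pair_distinguished p q :
  p != q -> distinguished (borel_pair p) (borel_pair q).
Proof. exact: pair_distinguished pairs_borel_distinguished erefl. Qed.

Lemma full_pair_distinguished p q :
  p != q -> distinguished (full_pair p) (full_pair q).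
Proof. exact: pair_distinguished pairs_full_distinguished erefl. Qed.

Lemma borel_pair_reach p : reach_borel (borel_pair p).
Proof.
have /(all_nthP [::])/(_ p (ltn_ord p)) := pairs_borel_reach.
by case/and3P=> /reach_quadP ? /reach_quadP ? /reach_quadP ?; apply: reach_borelI.
Qed.

Lemma full_pair_full p : full (full_pair p).
Proof.
have /(all_nthP [::])/(_ p (ltn_ord p)) := pairs_full_reach.
case/and4P=> /reach_quadP ? /reach_quadP ? /reach_quadP ? /reach_quadP ?.
by apply: fullI => //; apply: reach_borelI.
Qed.

Definition spread_quad (T : seq quad) : bool :=
  let bs := [seq (a, b) | a <- [:: true; false], b <- [:: true; false]] in
  let aff u := affine_expr u.1 u.2 varX in
  (size T == 2) && all (fun u => all (fun v =>
    (u == v) || quad_unit (ev_quad T (Minus (aff u) (aff v)))) bs) bs.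

Lemma spread_quadP T : spread_quad T ->
  spread (map quad_mx T)`_1 /\
  map quad_mx T = [:: (map quad_mx T)`_0; (map quad_mx T)`_1].
Proof.
case/andP=> sT h; split; last by case: T sT {h} => [|? [|? []]].
move=> a b a' b' ne; have mem (u v : bool) :
    (u, v) \in [seq (u, v) | u <- [:: true; false], v <- [:: true; false]].
  by case: u; case: v.
have /allP/(_ _ (mem a' b')) := allP h _ (mem a b).
rewrite (negbTE ne) orFb => /quad_unitP; rewrite -ev_quad_mx.
by rewrite /ev /= !eval_bit.
Qed.

Lemma pairs_borel_spread : all spread_quad pairs_borel.
Proof. by vm_compute. Qed.

Lemma pairs_full_spread : all spread_quad pairs_full.
Proof. by vm_compute. Qed.

Lemma borel_pair_spread p :
  spread (borel_pair p)`_1 /\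
  borel_pair p = [:: (borel_pair p)`_0; (borel_pair p)`_1].
Proof.
by apply: spread_quadP; apply: (allP pairs_borel_spread); apply: mem_nth.
Qed.

Lemma full_pair_spread p :
  spread (full_pair p)`_1 /\
  full_pair p = [:: (full_pair p)`_0; (full_pair p)`_1].
Proof.
by apply: spread_quadP; apply: (allP pairs_full_spread); apply: mem_nth.
Qed.

Lemma distinguished_pair_comm Z X Z' X' m (i : comm_index m) :
  distinguished [:: Z; X] [:: Z'; X'] ->
  distinguished (Z :: comm_tuple X i) (Z' :: comm_tuple X' i).
Proof.
by apply: (@distinguished_rename (head_at (comm_pos i) m)); apply: nth_head_at.
Qed.

Lemma reach_pair_comm Z X m (i : comm_index m) M :
  reach [:: Z; X] M -> reach (Z :: comm_tuple X i) M.
Proof. exact: (@reach_rename (head_at (comm_pos i) m)) (nth_head_at _ _ _). Qed.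

Lemma comm_tuple_comm X m (i : comm_index m) f g :
  GRing.comm (ev (comm_tuple X i) f) (ev (comm_tuple X i) g).
Proof.
have central Y k : GRing.comm Y X -> GRing.comm Y (nth 0 (comm_tuple X i) k).
  move=> hY; have bitY (b : bool) : GRing.comm Y b%:R by apply: commr_nat.
  elim: m i k => [|m IH] /= i k; first by rewrite nth_nil; apply: commr0.
  case: i k => [i|[[a b] i]] [|k] //=.
  - by have [b ->] := scalar_tuple_entry i k; apply: bitY.
  - by apply: commrD => //; apply: commrM.
apply: eval_comm => k; apply: (central); apply/commr_sym.
by apply: eval_comm => l; apply: central.
Qed.

(** * Telling triangular tuples apart *)

Lemma borel_tuple_reach m (i : borel_index m) : reach_borel (borel_tuple i).
Proof.
elim: m i => //= m IH [[p i]|[[[a b] d] i]] u v w.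
  apply: reach_pair_comm; have [_ <-] := borel_pair_spread p.
  exact: borel_pair_reach.
exact: reach_cons (IH _ _ _ _).
Qed.

Lemma borel_pair_upper p k : (nth 0 (borel_pair p) k) 1 0 = 0.
Proof.
have : all (all (fun q : quad => let: (_, _, c, _) := q in c == 0)) pairs_borel.
  by [].
move=> /(all_nthP [::])/(_ p (ltn_ord p)).
rewrite /borel_pair.
elim: (nth [::] pairs_borel p) k => [k|[[[a b] c] d] s IH [|k]] /=.
- by rewrite nth_nil mxE.
- by case/andP=> /eqP -> _; rewrite mxE.
- by case/andP=> _ /IH; apply.
Qed.

Lemma upper_eval (T : seq M2Z) f :
  (forall k, (nth 0 T k) 1 0 = 0) -> (ev T f) 1 0 = 0.
Proof.
move=> hT.
elim: f => [k||f hf g hg|f hf|f hf g hg]; rewrite /ev /= -?/(ev _ _) //.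
- by rewrite mx1 mx_E.
- by rewrite mxE hf hg addr0.
- by rewrite mxE hf oppr0.
- by rewrite mulmx2E hf hg mul0r mulr0 addr0.
Qed.

(** A commutator of triangular matrices is strictly triangular. *)
Lemma upper_com_sq (M N : M2Z) : M 1 0 = 0 -> N 1 0 = 0 ->
  (M * N - N * M) * (M * N - N * M) = 0.
Proof.
move=> hM hN; rewrite [M]mx_entries [N]mx_entries hM hN.
rewrite !(mxM, mxN, mxD) [RHS]mx0.
by congr mx; ring.
Qed.

Lemma affine_upper a b (X : M2Z) : X 1 0 = 0 -> (affine a b X) 1 0 = 0.
Proof.
by move=> hX; case: a; case: b; rewrite /affine ?(mul1r, mul0r) !mxE ?hX.
Qed.

Lemma borel_tuple_upper m (i : borel_index m) k :
  (nth 0 (borel_tuple i) k) 1 0 = 0.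
Proof.
elim: m i k => //= m IH [[p i]|[[[a b] d] i]] [|k] //=.
- exact: borel_pair_upper.
- have hX := borel_pair_upper p 1; move: (_`_1) hX => X hX.
  elim: m i k {IH p} => //= m IH [i|[[a b] i]] [|k] //=.
    by have [[] ->] := scalar_tuple_entry i k; rewrite !mxE.
  exact: affine_upper.
- by rewrite mx_E.
Qed.

(** E_01 is the commutator of E_00 and itself. *)
Lemma distinguished_comm_borel X m (i : comm_index m) (j : borel_index m) :
  distinguished (comm_tuple X i) (borel_tuple j).
Proof.
have [f hf] := borel_tuple_reach j 1 0 0.
have [g hg] := borel_tuple_reach j 0 1 0.
exists (Com f g); left; split.
  by rewrite /ev /= -!/(ev _ _) comm_tuple_comm subrr.
exists 0, 1; rewrite /ev /= -!/(ev _ _) hf hg !(mxM, mxN, mxD) mx_E.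
by [].
Qed.

Lemma ev_shift Z T f : ev (Z :: T) (rename succn f) = ev T f.
Proof. exact: (@ev_rename succn). Qed.

Lemma has_unit_bit_mx (a b c d a' b' c' d' : bool) :
  (a, b, c, d) != (a', b', c', d') -> has_unit (mx a b c d - mx a' b' c' d').
Proof.
move=> ne.
suff : quad_unit (a%:Z - a'%:Z, b%:Z - b'%:Z, c%:Z - c'%:Z, d%:Z - d'%:Z).
  by move/quad_unitP; rewrite mxN mxD.
move: ne; case: a; case: b; case: c; case: d;
  by case: a'; case: b'; case: c'; case: d'.
Qed.

(** When the tails agree, the tail alone produces the first entry of one of the
    tuples, which is compared with the first entry of the other. *)
Lemma distinguished_borel_tuple m (i j : borel_index m) :
  i != j -> distinguished (borel_tuple i) (borel_tuple j).
Proof.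
elim: m i j => [[]|m IH] //= [[p i]|[[[a b] d] i]] [[q j]|[[[a' b'] d'] j]] /=.
- have [-> pq|ij _] := eqVneq i j.
    apply: distinguished_pair_comm.
    have [_ <-] := borel_pair_spread p; have [_ <-] := borel_pair_spread q.
    by apply: borel_pair_distinguished; apply: contraNneq pq => ->.
  have [hp _] := borel_pair_spread p; have [hq _] := borel_pair_spread q.
  by apply: distinguished_cons; apply: distinguished_comm_tuple.
- by move=> _; apply/distinguished_cons/distinguished_comm_borel.
- by move=> _; apply/distinguished_cons/distinguished_sym/distinguished_comm_borel.
have [<- ne|/IH /distinguished_cons h _] := eqVneq i j; last exact: h.
have [f hf] := borel_tuple_reach i a' b' d'.
apply/distinguished_sym/(@distinguished_diff _ _ (Var 0) (rename succn f));
  rewrite ev_shift hf //.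
apply: (@has_unit_bit_mx a b false d a' b' false d').
by apply: contraNneq ne => -[-> -> ->].
Qed.

(** * Telling full tuples apart *)

(** The commutator of E_01 and E_10 is diag(1, -1), whose square is 1. *)
Lemma full_distinguished T S : full T ->
  (forall f g, ev S (Mul (Com f g) (Com f g)) = 0) -> distinguished S T.
Proof.
move=> fT hS; have [f hf] := fT (mx 0 1 0 0); have [g hg] := fT (mx 0 0 1 0).
exists (Mul (Com f g) (Com f g)); left; split; first exact: hS.
exists 0, 0; rewrite /ev /= -!/(ev _ _) hf hg !(mxM, mxN, mxD) mx_E.
by [].
Qed.

Lemma full_tuple_full m (i : full_index m) : full (full_tuple i).
Proof.
elim: m i => //= m IH [[[p i]|[[[a b] d] i]]|[[[[a b] c] d] i]] M.
- apply: reach_pair_comm; have [_ <-] := full_pair_spread p.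
  exact: full_pair_full.
- apply: fullI => [u v w|]; first exact/reach_cons/borel_tuple_reach.
  have E1 := reach_cons (mx a b 1 d) (borel_tuple_reach i 1 0 0).
  have E2 := reach_cons (mx a b 1 d) (borel_tuple_reach i 0 0 1).
  have := reachM (reachM E2 (reach_nth _ 0)) E1.
  by rewrite /= !mxM !(mul0r, mulr0, mul1r, mulr1, addr0, add0r).
- exact: reach_cons (IH _ _).
Qed.

(** The tail only produces triangular matrices, so it cannot be compared with the
    first entry Z directly; but the corners E_00 Z E_00, E_00 Z E_11 and
    E_11 Z E_11 are triangular and contain the entries in question. *)
Lemma distinguished_corner (a b d a' b' d' : bool) T :
  reach_borel T -> (a, b, d) != (a', b', d') ->
  distinguished (mx a b 1 d :: T) (mx a' b' 1 d' :: T).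
Proof.
move=> hT ne; have {ne} : [|| a != a', b != b' | d != d'].
  by move: ne; rewrite !xpair_eqE !negb_and -orbA.
have [e1 h1] := hT 1 0 0; have [e2 h2] := hT 0 0 1.
have unit_bits (u v : bool) : u != v -> (u%:Z - v%:Z) * (u%:Z - v%:Z) = 1.
  by case: u; case: v.
pose corner f g := Mul (Mul (rename succn f) (Var 0)) (rename succn g).
case/or3P=> /unit_bits hu.
- have [g hg] := hT a' 0 0.
  apply/distinguished_sym/(@distinguished_diff _ _ (corner e1 e1)
    (rename succn g));
    rewrite /ev /= -!/(ev _ _) !ev_shift h1 hg !(mxM, mxN, mxD).
    by congr mx; ring.
  by exists 0, 0; rewrite mx_E -[RHS]hu; ring.
- have [g hg] := hT 0 b' 0.
  apply/distinguished_sym/(@distinguished_diff _ _ (corner e1 e2)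
    (rename succn g));
    rewrite /ev /= -!/(ev _ _) !ev_shift h1 h2 hg !(mxM, mxN, mxD).
    by congr mx; ring.
  by exists 0, 1; rewrite mx_E -[RHS]hu; ring.
have [g hg] := hT 0 0 d'.
apply/distinguished_sym/(@distinguished_diff _ _ (corner e2 e2)
    (rename succn g));
  rewrite /ev /= -!/(ev _ _) !ev_shift h2 hg !(mxM, mxN, mxD).
  by congr mx; ring.
by exists 1, 1; rewrite mx_E -[RHS]hu; ring.
Qed.

Lemma distinguished_comm_full X m (i : comm_index m) (j : full_index m) :
  distinguished (comm_tuple X i) (full_tuple j).
Proof.
apply: full_distinguished; first exact: full_tuple_full.
by move=> f g; rewrite /ev /= -!/(ev _ _) comm_tuple_comm subrr mul0r.
Qed.

Lemma distinguished_borel_full m (i : borel_index m) (j : full_index m) :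
  distinguished (borel_tuple i) (full_tuple j).
Proof.
apply: full_distinguished; first exact: full_tuple_full.
by move=> f g; apply: upper_com_sq; apply: upper_eval; apply: borel_tuple_upper.
Qed.

Lemma distinguished_full_tuple m (i j : full_index m) :
  i != j -> distinguished (full_tuple i) (full_tuple j).
Proof.
elim: m i j => [[]|m IH] //=.
move=> [[[p i]|[[[a b] d] i]]|[[[[a b] c] d] i]]
  [[[q j]|[[[a' b'] d'] j]]|[[[[a' b'] c'] d'] j]] /=.
- have [-> pq|ij _] := eqVneq i j.
    apply: distinguished_pair_comm.
    have [_ <-] := full_pair_spread p; have [_ <-] := full_pair_spread q.
    by apply: full_pair_distinguished; apply: contraNneq pq => ->.
  have [hp _] := full_pair_spread p; have [hq _] := full_pair_spread q.
  by apply: distinguished_cons; apply: distinguished_comm_tuple.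
- by move=> _; apply/distinguished_cons/distinguished_comm_borel.
- by move=> _; apply/distinguished_cons/distinguished_comm_full.
- by move=> _; apply/distinguished_cons/distinguished_sym/distinguished_comm_borel.
- have [<- ne|/distinguished_borel_tuple/distinguished_cons h _] := eqVneq i j;
    last exact: h.
  apply: distinguished_corner; first exact: borel_tuple_reach.
  by apply: contraNneq ne => -[-> -> ->].
- by move=> _; apply/distinguished_cons/distinguished_borel_full.
- by move=> _; apply/distinguished_cons/distinguished_sym/distinguished_comm_full.
- by move=> _; apply/distinguished_cons/distinguished_sym/distinguished_borel_full.
have [<- ne|/IH /distinguished_cons h _] := eqVneq i j; last exact: h.
have [f hf] := full_tuple_full i (mx a' b' c' d').
apply/distinguished_sym/(@distinguished_diff _ _ (Var 0) (rename succn f));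
  rewrite ev_shift hf //.
by apply: has_unit_bit_mx; apply: contraNneq ne => -[-> -> -> ->].
Qed.

Lemma has_generators_le m K : (K <= #|full_index m|)%N ->
  has_generators (matrix_ring_power 2 K) m.
Proof.
move=> hK; pose T (i : 'I_K) := full_tuple (enum_val (widen_ord hK i)).
apply: (@has_generators_of_family _ _ T) => [i|i|i j ij].
- exact: size_full_tuple.
- exact: full_tuple_full.
apply: distinguished_separated; try exact: full_tuple_full.
apply: distinguished_full_tuple.
apply: contraNneq ij => /enum_val_inj /(congr1 val) /= e.
exact/eqP/val_inj.
Qed.

(** * Reduction modulo 2 and the conjugation action *)

Local Notation M2F := 'M['F_2]_2.

Lemma generates_ind (A : pzRingType) (S : {pred A}) (W : A -> Prop) :
  generates S -> W 0 -> (forall a b, W a -> W b -> W (a + b)) ->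
  (forall a, W a -> W (- a)) ->
  (forall a b, W a -> W b -> W (a * b)) -> (forall a, a \in S -> W a) ->
  forall a, W a.
Proof.
move=> gS W0 WD WN WM WS a; have [c [hc ->]] := gS a.
rewrite big_seq; apply: big_ind => // t /hc [t0 tS].
have Wn b n : W b -> W (b *+ n).
  by move=> Wb; elim: n => [|n IH]; rewrite ?mulr0n // mulrS; apply: WD.
have {Wn} Wz b z : W b -> W (b *~ z).
  by case: z => n /Wn h; [apply: h|apply/WN/h].
apply: Wz; case: t.2 t0 tS => // u w _ tS.
elim: w u tS => [|v w IH] u tS.
  by rewrite big_seq1; apply/WS/tS/mem_head.
rewrite big_cons; apply: WM; first exact/WS/tS/mem_head.
by apply: IH => y yw; apply: tS; rewrite inE yw orbT.
Qed.

Definition red : M2Z -> M2F := map_mx intr.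

Lemma red_surj N : exists M, red M = N.
Proof.
exists (map_mx (fun u : 'F_2 => (val u)%:Z) N).
by apply/matrixP=> i j; rewrite !mxE -pmulrn natr_Zp.
Qed.

Lemma F2_cases (u : 'F_2) : u = (u != 0)%:R.
Proof. by case: u => [[|[|]]] // h; apply/val_inj. Qed.

Lemma central_scalar (C : M2F) : C \is a GRing.unit ->
  (forall N, C * N = N * C) -> C = 1.
Proof.
move=> uC hC.
have h10 : C 1 0 = 0.
  have /matrixP/(_ 1 1) := hC (delta_mx 0 1).
  by rewrite !mulmx2E !mxE /= !(mulr0, mulr1, mul0r, mul1r, addr0, add0r).
have h01 : C 0 1 = 0.
  have /matrixP/(_ 0 0) := hC (delta_mx 1 0).
  by rewrite !mulmx2E !mxE /= !(mulr0, mulr1, mul0r, mul1r, addr0, add0r).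
have h00 : C 0 0 = C 1 1.
  have /matrixP/(_ 0 1) := hC (delta_mx 0 1).
  by rewrite !mulmx2E !mxE /= !(mulr0, mulr1, mul0r, mul1r, addr0, add0r).
have CE : C = (C 0 0)%:M.
  by apply/matrixP; elim/ord2_ind; elim/ord2_ind; rewrite [RHS]mxE ?mulr1n ?mulr0n.
rewrite CE [C 0 0]F2_cases; case: eqVneq => // C0.
by rewrite CE C0 raddf0 unitr0 in uC.
Qed.

Definition conjF2 (g : {'GL_2['F_2]}) (N : M2F) : M2F := val g * N / val g.

Lemma conjF2_0 g : conjF2 g 0 = 0. Proof. by rewrite /conjF2 mulr0 mul0r. Qed.

Lemma conjF2_1 g : conjF2 g 1 = 1.
Proof. by rewrite /conjF2 mulr1 divrr // (valP g). Qed.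

Lemma conjF2_D g M N : conjF2 g (M + N) = conjF2 g M + conjF2 g N.
Proof. by rewrite /conjF2 mulrDr mulrDl. Qed.

Lemma conjF2_N g N : conjF2 g (- N) = - conjF2 g N.
Proof. by rewrite /conjF2 mulrN mulNr. Qed.

Lemma conjF2_M g M N : conjF2 g (M * N) = conjF2 g M * conjF2 g N.
Proof. by rewrite /conjF2 !mulrA divrK // (valP g). Qed.

Lemma conjF2_surj g N : exists M, conjF2 g M = N.
Proof.
exists ((val g)^-1 * N * val g).
by rewrite /conjF2 !mulrA divrr ?mul1r ?mulrK // (valP g).
Qed.

Lemma conjF2_inj g h : conjF2 g =1 conjF2 h -> g = h.
Proof.
move=> e; apply/val_inj; have [ug uh] := (valP g, valP h).
suff E : (val h)^-1 * val g = 1 by rewrite -[RHS]mulr1 -E mulrA divrr ?mul1r.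
apply: central_scalar => [|N]; first by rewrite unitrMl ?unitrV.
have /(congr1 (fun M => (val h)^-1 * M * val g)) := e N.
by rewrite /conjF2 !mulrA mulrVK // mulVr // mul1r.
Qed.

Definition subring_pred (P : pred M2F) : Prop :=
  [/\ P 0, forall M N, P M -> P N -> P (M + N), forall N, P N -> P (- N)
    & forall M N, P M -> P N -> P (M * N)].

Section Bound.
Variables (K m m' : nat) (s : m'.-tuple (matrix_ring_power 2 K)).
Hypotheses (le_m : (m' <= m)%N) (gen_s : generates [in s]).

(** The i-th components of the generators, reduced modulo 2 and conjugated by g;
    [le_m] lets fewer than m generators be padded with zeros. *)
Definition orbit_tuple (p : 'I_K * {'GL_2['F_2]}) : {ffun 'I_m -> M2F} :=
  [ffun k : 'I_m => conjF2 p.2 (red ((nth 0 s k) p.1))].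

Lemma mem_generator a : a \in s -> exists k : 'I_m, a = nth 0 s k.
Proof.
move=> sa; have km : (index a s < m)%N.
  by apply: leq_trans le_m; have := index_mem a s; rewrite sa size_tuple.
by exists (Ordinal km); rewrite nth_index.
Qed.

(** If g conjugates the i-th tuple to what h makes of the j-th one, the same
    relation holds between the components i and j of every element of the
    power, since these elements form a subring; an idempotent of the i-th factor
    rules out distinct i and j. *)
Lemma orbit_tuple_inj : injective orbit_tuple.
Proof.
move=> [i g] [j h] /ffunP e.
have W (a : matrix_ring_power 2 K) : conjF2 g (red (a i)) = conjF2 h (red (a j)).
  pose W (a : matrix_ring_power 2 K) :=
    conjF2 g (red (a i)) = conjF2 h (red (a j)).
  move: a; apply: (generates_ind (W := W) gen_s)
    => [|a b|a|a b|a /mem_generator [k ->]]; rewrite /W.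
  - by rewrite !ffunE /red !raddf0 !conjF2_0.
  - by rewrite !ffunE /red !raddfD !conjF2_D => -> ->.
  - by rewrite !ffunE /red !raddfN !conjF2_N => ->.
  - by rewrite !ffunE /red !rmorphM !conjF2_M => -> ->.
  - by have := e k; rewrite !ffunE.
have ij : i = j.
  apply/eqP/negPn/negP=> ij.
  have := W [ffun k => if k == i then 1 else 0].
  rewrite !ffunE eqxx eq_sym (negbTE ij).
  by rewrite /red rmorph1 rmorph0 conjF2_1 conjF2_0 => /eqP; rewrite oner_eq0.
subst j; congr (_, _); apply: conjF2_inj => N; have [M <-] := red_surj N.
by have := W [ffun=> M]; rewrite !ffunE.
Qed.

Lemma orbit_tuple_proper P p : subring_pred P -> (exists N, ~~ P N) ->
  ~~ [forall k, P (orbit_tuple p k)].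
Proof.
case: p => i g [P0 PD PN PM] [N PNN]; apply: contra PNN => /forallP h.
have [N1 <-] := conjF2_surj g N; have [M <-] := red_surj N1.
have W (a : matrix_ring_power 2 K) : P (conjF2 g (red (a i))).
  pose W (a : matrix_ring_power 2 K) := P (conjF2 g (red (a i))) : Prop.
  move: a; apply: (generates_ind (W := W) gen_s)
    => [|a b|a|a b|a /mem_generator [k ->]]; rewrite /W.
  - by rewrite !ffunE /red raddf0 conjF2_0.
  - by rewrite !ffunE /red raddfD conjF2_D; apply: PD.
  - by rewrite !ffunE /red raddfN conjF2_N; apply: PN.
  - by rewrite !ffunE /red rmorphM conjF2_M; apply: PM.
  - by have := h k; rewrite !ffunE.
by have := W [ffun=> M]; rewrite ffunE.
Qed.

End Bound.

(** * Counting the generating tuples over the field with two elements *)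

Lemma card_entries (Q : 'F_2 -> 'F_2 -> 'F_2 -> 'F_2 -> bool) :
  #|[set N : M2F | Q (N 0 0) (N 0 1) (N 1 0) (N 1 1)]| =
  (\sum_(a : bool) \sum_(b : bool) \sum_(c : bool) \sum_(d : bool)
     Q a%:R b%:R c%:R d%:R)%N.
Proof.
pose mxF (q : bool * bool * bool * bool) : M2F := let: (a, b, c, d) := q in
  \matrix_(i, j) if i == 0 then (if j == 0 then a%:R else b%:R)
                 else (if j == 0 then c%:R else d%:R).
have mxF_bij : bijective mxF.
  exists (fun N : M2F => (N 0 0 != 0, N 0 1 != 0, N 1 0 != 0, N 1 1 != 0)).
    by case=> [[[[] []] []] []]; rewrite !mxE.
  move=> N; apply/matrixP; elim/ord2_ind; elim/ord2_ind;
    by rewrite mxE /= -F2_cases.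
rewrite !pair_bigA -sum1dep_card big_mkcond /= (reindex mxF) /=.
  by apply: eq_bigr => -[[[a b] c] d] _ /=; rewrite !mxE /=; case: Q.
exact: onW_bij mxF_bij.
Qed.

Definition tuples_in (m : nat) (P : pred M2F) : {set {ffun 'I_m -> M2F}} :=
  [set t : {ffun 'I_m -> M2F} | [forall k, P (t k)]].

Lemma tuples_inI m P Q :
  tuples_in m P :&: tuples_in m Q = tuples_in m (fun N => P N && Q N).
Proof.
apply/setP=> t; rewrite !inE; apply/andP/forallP => [[/forallP hP /forallP hQ] k|h].
  by rewrite hP hQ.
by split; apply/forallP=> k; case/andP: (h k).
Qed.

Lemma card_tuples_in m P : #|tuples_in m P| = (#|[set N | P N]| ^ m)%N.
Proof.
rewrite -[m in RHS]card_ord -card_ffun_on; apply: eq_card => t; rewrite !inE.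
by apply/forallP/ffun_onP => h k; have := h k; rewrite inE.
Qed.

(** The stabilisers of the three lines of F_2^2, spanned by (1, 0), (0, 1) and
    (1, 1), and the field F_2[w] with w^2 = w + 1. *)
Definition upper : pred M2F := fun N => N 1 0 == 0.
Definition lower : pred M2F := fun N => N 0 1 == 0.
Definition diag_line : pred M2F := fun N => N 0 0 + N 0 1 == N 1 0 + N 1 1.
Definition field4 : pred M2F :=
  fun N => (N 0 1 == N 1 0) && (N 1 1 == N 0 0 + N 0 1).

Lemma upper_subring : subring_pred upper.
Proof.
rewrite /upper; split=> [|M N|N|M N]; rewrite ?mulmx2E ?mxE //.
- by move=> /eqP -> /eqP ->; rewrite addr0.
- by move=> /eqP ->; rewrite oppr0.
- by move=> /eqP -> /eqP ->; rewrite mul0r mulr0 addr0.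
Qed.

Lemma lower_subring : subring_pred lower.
Proof.
rewrite /lower; split=> [|M N|N|M N]; rewrite ?mulmx2E ?mxE //.
- by move=> /eqP -> /eqP ->; rewrite addr0.
- by move=> /eqP ->; rewrite oppr0.
- by move=> /eqP -> /eqP ->; rewrite mul0r mulr0 addr0.
Qed.

Lemma diag_line_subring : subring_pred diag_line.
Proof.
rewrite /diag_line; split=> [|M N|N|M N]; rewrite ?mulmx2E ?mxE //.
- by move=> /eqP e /eqP e'; apply/eqP; rewrite addrACA e e' addrACA.
- by rewrite -!opprD eqr_opp.
- move=> /eqP e /eqP e'; apply/eqP.
  have -> : M 1 1 = M 0 0 + M 0 1 - M 1 0 by rewrite e addrC addKr.
  have -> : N 1 1 = N 0 0 + N 0 1 - N 1 0 by rewrite e' addrC addKr.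
  ring.
Qed.

Lemma field4_subring : subring_pred field4.
Proof.
rewrite /field4; split=> [|M N|N|M N]; rewrite ?mulmx2E ?mxE ?addr0 ?eqxx //.
- by move=> /andP[/eqP -> /eqP ->] /andP[/eqP -> /eqP ->]; rewrite eqxx addrACA eqxx.
- by move=> /andP[/eqP -> /eqP ->]; rewrite opprD !eqxx.
- move=> /andP[/eqP e1 /eqP e2] /andP[/eqP e3 /eqP e4].
  apply/andP; split; apply/eqP; rewrite e2 e4 -e1 -e3; ring.
Qed.

Lemma card_upper : #|[set N | upper N]| = 8%N.
Proof.
by rewrite (card_entries (fun _ _ c _ => c == 0)) !big_bool.
Qed.

Lemma card_lower : #|[set N | lower N]| = 8%N.
Proof.
by rewrite (card_entries (fun _ b _ _ => b == 0)) !big_bool.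
Qed.

Lemma card_diag_line : #|[set N | diag_line N]| = 8%N.
Proof.
by rewrite (card_entries (fun a b c d => a + b == c + d)) !big_bool.
Qed.

Lemma card_field4 : #|[set N | field4 N]| = 4%N.
Proof.
by rewrite (card_entries (fun a b c d => (b == c) && (d == a + b))) !big_bool.
Qed.

Lemma card_upper_lower : #|[set N | upper N && lower N]| = 4%N.
Proof.
by rewrite (card_entries (fun _ b c _ => (c == 0) && (b == 0))) !big_bool.
Qed.

Lemma card_upper_diag : #|[set N | upper N && diag_line N]| = 4%N.
Proof.
by rewrite (card_entries (fun a b c d => (c == 0) && (a + b == c + d))) !big_bool.
Qed.

Lemma card_lower_diag : #|[set N | lower N && diag_line N]| = 4%N.
Proof.
by rewrite (card_entries (fun a b c d => (b == 0) && (a + b == c + d))) !big_bool.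
Qed.

Lemma card_lines :
  #|[set N | (upper N && diag_line N) && (lower N && diag_line N)]| = 2%N.
Proof.
by rewrite (card_entries (fun a b c d => ((c == 0) && (a + b == c + d)) &&
    ((b == 0) && (a + b == c + d)))) !big_bool.
Qed.

Lemma card_upper_field4 : #|[set N | upper N && field4 N]| = 2%N.
Proof.
by rewrite (card_entries (fun a b c d => (c == 0) && ((b == c) && (d == a + b)))) !big_bool.
Qed.

Definition bad m := tuples_in m upper :|: tuples_in m lower :|:
  tuples_in m diag_line :|: tuples_in m field4.

(** Two of the stabilisers meet in 4 matrices; all three, or one of them and
    F_4, meet in the scalars 0 and 1. *)
Lemma card_bad m : (#|bad m| + 2 * 4 ^ m = 3 * 8 ^ m)%N.
Proof.
have eq_field4 P : (forall N, field4 N -> P N = upper N) ->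
    tuples_in m P :&: tuples_in m field4 = tuples_in m upper :&: tuples_in m field4.
  move=> eP; rewrite !tuples_inI; apply/setP=> t; rewrite !inE.
  apply: eq_forallb => k; rewrite andbC [RHS]andbC.
  by case h: (field4 _) => //=; apply: eP.
have lowerE N : field4 N -> lower N = upper N.
  by rewrite /lower /upper => /andP[/eqP -> _].
have diagE N : field4 N -> diag_line N = upper N.
  move=> /andP[_ /eqP e]; rewrite /diag_line /upper e eq_sym.
  by rewrite -subr_eq0 addrK.
have := cardsUI (tuples_in m upper) (tuples_in m lower).
have := cardsUI (tuples_in m upper :|: tuples_in m lower) (tuples_in m diag_line).
have := cardsUI (tuples_in m upper :|: tuples_in m lower :|: tuples_in m diag_line)
  (tuples_in m field4).
have := cardsUI (tuples_in m upper :&: tuples_in m diag_line)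
  (tuples_in m lower :&: tuples_in m diag_line).
rewrite -/(bad m) !setIUl (eq_field4 _ lowerE) (eq_field4 _ diagE) !setUid.
rewrite !tuples_inI !card_tuples_in card_upper card_lower card_diag_line card_field4.
rewrite card_upper_lower card_upper_diag card_lower_diag card_lines card_upper_field4.
lia.
Qed.

Lemma has_generators_bound K m' m : (m' <= m)%N ->
  has_generators (matrix_ring_power 2 K) m' ->
  (K * 6 + 3 * 8 ^ m <= 16 ^ m + 2 * 4 ^ m)%N.
Proof.
move=> le_m [s gen_s]; have inj := orbit_tuple_inj le_m gen_s.
have sub : [set orbit_tuple m s p | p : 'I_K * {'GL_2['F_2]}] \subset ~: bad m.
  apply/subsetP=> _ /imsetP[p _ ->]; rewrite !inE !negb_or.
  have proper := orbit_tuple_proper le_m gen_s p.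
  rewrite !proper //.
  - exact: field4_subring.
  - by exists (delta_mx 0 1); rewrite /field4 !mxE.
  - exact: diag_line_subring.
  - by exists (delta_mx 0 0); rewrite /diag_line !mxE.
  - exact: lower_subring.
  - by exists (delta_mx 0 1); rewrite /lower !mxE.
  - exact: upper_subring.
  - by exists (delta_mx 1 0); rewrite /upper !mxE.
have := subset_leq_card sub; rewrite card_imset // card_prod card_ord.
have -> : #|{: {'GL_2['F_2]}}| = 6%N by rewrite -cardsT card_GL_2 card_Fp.
have := cardsC (bad m); rewrite card_ffun card_mx card_Fp // card_ord.
rewrite (_ : 2 ^ (2 * 2) = 16)%N //; have := card_bad m.
by move: #|bad m| #|~: bad m| => u v; lia.
Qed.

(** * The value of gen_{m,2}(Z) *)

Lemma is_gen_iff m N : is_gen m 2 N <-> N = #|full_index m|.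
Proof.
have bound K m' : (m' <= m)%N -> has_generators (matrix_ring_power 2 K) m' ->
    (K <= #|full_index m|)%N.
  by move=> le_m /(has_generators_bound le_m); have := card_full_index m; lia.
split=> [[hN hN1]|->].
  apply/eqP; rewrite eqn_leq (bound _ m) //= leqNgt; apply/negP=> lt.
  by have := hN1 m (has_generators_le lt); rewrite ltnn.
split=> [|m' h]; first exact: has_generators_le.
by rewrite ltnNge; apply/negP=> le_m; have := bound _ _ le_m h; rewrite ltnn.
Qed.

Theorem theorem3p6 :
  has_generators (matrix_ring_power 2 16) 2 /\
  smallest_number_of_generators (matrix_ring_power 2 17) 3 /\
  (forall m : nat, (2 <= m)%N ->
     exists N : nat,
       unique (is_gen m 2) N /\
       N%:R = (16%:R ^+ m - 3%:R * 8%:R ^+ m + 2%:R * 4%:R ^+ m) / 6%:R :> rat).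
Proof.
have F2 : #|full_index 2| = 16%N by have := card_full_index 2; lia.
have F3 : (17 <= #|full_index 3|)%N by have := card_full_index 3; lia.
have [gen16 min17] : is_gen 2 2 16 by apply/is_gen_iff.
split=> //; split; first by split; [exact: has_generators_le|exact: min17].
move=> m _; exists #|full_index m|; split.
  by split=> [|N /is_gen_iff ->] //; apply/is_gen_iff.
apply: (@mulIf _ 6%:R) => //; rewrite divfK //.
have /(congr1 (fun n => n%:R : rat)) := card_full_index m.
rewrite /= natrD [in RHS]natrD !natrM !natrX => e.
by rewrite addrAC -e addrK.
Qed.
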